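(* Let $(P,\preccurlyeq)$ be a poset, let $V$ and $V'$ be $(\mathbb{R}\times P)$-modules, and let $d_P$ and $d_P'$ be extended quasimetrics on $P$. Let $d$ and $d'$ be the extended quasimetrics on $\mathbb{R}\times P$ constructed from $d_P$ and $d_P'$ respectively, where either both are the sum quasimetrics or both are the max quasimetrics. Let $\lambda_V$ be the generalized persistence landscape of $V$ with respect to $d$ and $\lambda_{V'}$ the generalized persistence landscape of $V'$ with respect to $d'$. Then $$\|\lambda_V-\lambda_{V'}\|_\infty\le\mathsf{Int}(V,V')+\|d_P-d_P'\|_\infty .$$
   Context: Fix a field $\mathbb{F}$. For a poset $Q$, a $Q$-module is a functor $V:Q\to\mathrm{Vect}_{\mathbb{F}}$ from the poset category $Q$ to $\mathbb{F}$-vector spaces; morphisms are natural transformations. $\mathbb{R}\times P$ carries the product order, also denoted $\preccurlyeq$. For an $(\mathbb{R}\times P)$-module $V$ and $\epsilon\ge0$, the shift $V_\epsilon$ is $V_\epsilon(r,p):=V(r+\epsilon,p)$. Modules $V,V'$ are $\epsilon$-interleaved if there are morphisms $\phi:V\to V'_\epsilon$ and $\psi:V'\to V_\epsilon$ such that $\psi_{r+\epsilon,p}\circ\phi_{r,p}=V((r,p)\preccurlyeq(r+2\epsilon,p))$ and $\phi_{r+\epsilon,p}\circ\psi_{r,p}=V'((r,p)\preccurlyeq(r+2\epsilon,p))$ for all $(r,p)$. $\mathsf{Int}(V,V'):=\inf\{\epsilon\ge0 : V,V'\text{ are }\epsilon\text{-interleaved}\}$, with $\inf\emptyset:=+\infty$.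 An extended quasimetric on a set $S$ is a function $d:S\times S\to[0,+\infty]$ with $d(x,y)=0$ iff $x=y$ and $d(x,z)\le d(x,y)+d(y,z)$ (no symmetry required). Given an extended quasimetric $d_P$ on $P$, the sum quasimetric on $\mathbb{R}\times P$ is $((r,x),(s,y))\mapsto d_P(x,y)+|r-s|$ and the max quasimetric is $((r,x),(s,y))\mapsto\max\{d_P(x,y),|r-s|\}$. For a $Q$-module $V$ and $a\preccurlyeq b$ in $Q$, $\beta_V^{a,b}:=\mathrm{rank}(V(a\preccurlyeq b))$. The generalized persistence landscape of $V$ with respect to an extended quasimetric $d$ on $Q$ is $\lambda_V:\mathbb{Z}_{\ge0}\times Q\to[0,+\infty]$, $$\lambda_V(n,x):=\sup\{\epsilon\ge0 : \beta_V^{a,b}\ge n\text{ for all }a,b\in Q\text{ with }a\preccurlyeq x\preccurlyeq b,\ d(a,x)\le\epsilon,\ d(x,b)\le\epsilon\},$$ with $\sup\emptyset:=0$. $\|\cdot\|_\infty$ denotes the sup-norm (over $\mathbb{Z}_{\ge0}\times(\mathbb{R}\times P)$ for landscapes and over $P\times P$ for quasimetrics), allowed to take the value $+\infty$; where both functions take the value $+\infty$ their difference is taken to be $0$. *)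

(* Defs.v *)
From mathcomp Require Import all_boot all_order all_algebra.
From mathcomp Require Import all_classical all_reals all_analysis.

Set Implicit Arguments.
Unset Strict Implicit.
Unset Printing Implicit Defensive.

Import Order.TTheory GRing.Theory Num.Theory.

Local Open Scope classical_set_scope.
Local Open Scope ring_scope.
Local Open Scope ereal_scope.

Section ExtendedNonneg.
Context {R : realType}.

(* The supremum in the complete lattice [0, +oo]: unlike ereal_sup, it
   sends the empty set to 0. *)
Definition nonneg_sup (A : set \bar R) : \bar R := ereal_sup (0 |` A).

(* The case distinction is needed: `|+oo - +oo| = +oo in \bar R. *)
Definition absdiff (x y : \bar R) : \bar R :=
  if (x == +oo) && (y == +oo) then 0 else `|x - y|.

(* || f - g ||_oo for [0, +oo]-valued f and g *)
Definition supdist (T : Type) (f g : T -> \bar R) : \bar R :=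
  nonneg_sup (range (fun t => absdiff (f t) (g t))).

Record extended_quasimetric (S : Type) (d : S * S -> \bar R) : Prop := {
  eqm_ge0 : forall x y, 0 <= d (x, y);
  eqm_eq0 : forall x y, d (x, y) = 0 <-> x = y;
  eqm_triangle : forall x y z, d (x, z) <= d (x, y) + d (y, z) }.

End ExtendedNonneg.

Definition lin_indep (F : fieldType) (U : lmodType F) (m : nat)
    (v : 'I_m -> U) : Prop :=
  forall c : 'I_m -> F, (\sum_(i < m) c i *: v i = 0 -> forall i, c i = 0)%R.

(* Dimension in {0, 1, 2, ..., +oo} of a linear subspace S of U; all infinite
   cardinals are identified with +oo, as dimensions are only ever compared with
   natural numbers. *)
Definition dimension (R : realType) (F : fieldType) (U : lmodType F)
    (S : set U) : \bar R :=
  ereal_sup [set m%:R%:E | m in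
    [set m : nat | exists v : 'I_m -> U, lin_indep v /\ forall i, S (v i)]].

Definition rank (R : realType) (F : fieldType) (U W : lmodType F)
    (f : {linear U -> W}) : \bar R := dimension R (range f).

Record pmodule (F : fieldType) (disp : Order.disp_t) (Q : porderType disp) := {
  pm_obj :> Q -> lmodType F;
  pm_map : forall a b : Q, (a <= b)%O -> {linear pm_obj a -> pm_obj b};
  pm_id : forall (a : Q) (aa : (a <= a)%O) (v : pm_obj a), pm_map aa v = v;
  pm_comp : forall (a b c : Q) (ab : (a <= b)%O) (bc : (b <= c)%O)
      (ac : (a <= c)%O) (v : pm_obj a),
    pm_map ac v = pm_map bc (pm_map ab v) }.
Arguments pm_map {F disp Q} V {a b} : rename.

Record pmorphism (F : fieldType) (disp : Order.disp_t) (Q : porderType disp)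
    (V W : pmodule F Q) := {
  pmor :> forall a : Q, {linear V a -> W a};
  pmor_natural : forall (a b : Q) (ab : (a <= b)%O) (v : V a),
    pmor b (pm_map V ab v) = pm_map W ab (pmor a v) }.

(* beta_V^{a,b} *)
Definition rank_invariant (R : realType) (F : fieldType) (disp : Order.disp_t)
    (Q : porderType disp) (V : pmodule F Q) (a b : Q) (ab : (a <= b)%O)
    : \bar R := rank R (pm_map V ab).

Definition landscape (R : realType) (F : fieldType) (disp : Order.disp_t)
    (Q : porderType disp) (d : Q * Q -> \bar R) (V : pmodule F Q)
    (nx : nat * Q) : \bar R :=
  let: (n, x) := nx in
  nonneg_sup [set e%:E | e in [set e : R | (0 <= e)%R /\
    forall (a b : Q) (ax : (a <= x)%O) (xb : (x <= b)%O),
      d (a, x) <= e%:E -> d (x, b) <= e%:E ->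
      n%:R%:E <= rank_invariant R V (le_trans ax xb)]].

Section RealTimesPoset.
Context {R : realType} {disp : Order.disp_t} {P : porderType disp}.

(* R *p P is the product R * P with the componentwise order. *)
Definition shift_pt (e : R) (x : R *p P) : R *p P := ((x.1 + e)%R, x.2).

Lemma shift_pt_homo (e : R) (x y : R *p P) :
  (x <= y)%O -> (shift_pt e x <= shift_pt e y)%O.
Proof.
by case: x y => [r p] [s q]; rewrite /shift_pt !leEprod /= lerD2r.
Qed.

Lemma shift_pt_ge (e : R) (e0 : (0 <= e)%R) (x : R *p P) :
  (x <= shift_pt e x)%O.
Proof. by case: x => r p; rewrite /shift_pt leEprod /= lerDl e0 lexx. Qed.

Definition pm_shift (F : fieldType) (e : R) (V : pmodule F (R *p P)) :
  pmodule F (R *p P).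
Proof.
refine {| pm_obj := fun x => V (shift_pt e x);
          pm_map := fun x y xy => pm_map V (shift_pt_homo e xy) |}.
- by move=> a aa v; exact: pm_id.
- by move=> a b c ab bc ac v; exact: pm_comp.
Defined.

Lemma shift2_ge (e : R) (e0 : (0 <= e)%R) (x : R *p P) :
  (x <= shift_pt e (shift_pt e x))%O.
Proof. exact: le_trans (shift_pt_ge e0 x) (shift_pt_ge e0 _). Qed.

(* The point (r + 2 e, p) is written (r + e + e, p), so that both sides of each
   identity have the same type. *)
Definition interleaved (F : fieldType) (V V' : pmodule F (R *p P)) (e : R)
    (e0 : (0 <= e)%R) : Prop :=
  exists (phi : pmorphism V (pm_shift e V'))
         (psi : pmorphism V' (pm_shift e V)),
    (forall (x : R *p P) (v : V x),
      psi (shift_pt e x) (phi x v) = pm_map V (shift2_ge e0 x) v) /\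
    (forall (x : R *p P) (v : V' x),
      phi (shift_pt e x) (psi x v) = pm_map V' (shift2_ge e0 x) v).

Definition interleaving_dist (F : fieldType) (V V' : pmodule F (R *p P))
    : \bar R :=
  ereal_inf [set e%:E | e in
    [set e : R | exists e0 : (0 <= e)%R, interleaved V V' e0]].

Definition sum_quasimetric (dP : P * P -> \bar R)
    (xy : (R *p P) * (R *p P)) : \bar R :=
  let: (x, y) := xy in dP (x.2, y.2) + `|x.1 - y.1|%:E.

Definition max_quasimetric (dP : P * P -> \bar R)
    (xy : (R *p P) * (R *p P)) : \bar R :=
  let: (x, y) := xy in maxe (dP (x.2, y.2)) `|x.1 - y.1|%:E.

End RealTimesPoset.

(* Main.v *)
(** If [V] and [V'] are [e]-interleaved, then [V (shift (-e) a <= shift e b)]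
    factors through [V' (a <= b)], so the rank of the latter is at least that of
    the former. Passing from [(a, b)] to [(shift (-e) a, shift e b)] and from
    [d'] to [d] increases distances to [x] by at most [e + |d_P - d_P'|].
    Hence every radius [r] admissible for [V] yields the radius
    [r - e - |d_P - d_P'|] admissible for [V']. *)

Require Import Defs.
From mathcomp Require Import all_boot all_order all_algebra.
From mathcomp Require Import all_classical all_reals all_analysis.
From mathcomp Require Import lra.

Set Implicit Arguments.
Unset Strict Implicit.
Unset Printing Implicit Defensive.

Import Order.TTheory GRing.Theory Num.Theory.

Local Open Scope ring_scope.
Local Open Scope ereal_scope.

Section NonnegExtended.
Context {R : realType}.
Implicit Types (x y C : \bar R) (A : set (\bar R)).

Lemma nonneg_sup_ge0 A : 0 <= nonneg_sup A.
Proof. by apply: ereal_sup_ubound; left. Qed.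

Lemma nonneg_sup_ub A x : A x -> x <= nonneg_sup A.
Proof. by move=> Ax; apply: ereal_sup_ubound; right. Qed.

Lemma nonneg_sup_le A C : 0 <= C -> (forall x, A x -> x <= C) ->
  nonneg_sup A <= C.
Proof. by move=> C0 AC; apply: ge_ereal_sup => x /= [->|/AC]. Qed.

Lemma absdiffC x y : absdiff x y = absdiff y x.
Proof.
by rewrite /absdiff; case: x y => [x| |] [y| |] //=; rewrite distrC.
Qed.

(** If both values are [+oo], [absdiff] is 0; if exactly one is, the two one-sided bounds force [C]
    to be [+oo]. *)
Lemma absdiff_le x y C : 0 <= x -> 0 <= y -> 0 <= C ->
  x <= y + C -> y <= x + C -> absdiff x y <= C.
Proof.
rewrite /absdiff; case: x => [x| |] //; case: y => [y| |] //;
  case: C => [c| |] //=; rewrite ?leey // !lee_fin => *.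
by rewrite ler_norml; apply/andP; split; lra.
Qed.

Lemma le_add_absdiff x y : 0 <= x -> 0 <= y -> x <= y + absdiff x y.
Proof.
rewrite /absdiff; case: x => [x| |] //; case: y => [y| |] //=;
  rewrite ?leey // !lee_fin => x0 y0.
by have := ler_norm (x - y)%R; lra.
Qed.

Lemma supdistC (T : Type) (f g : T -> \bar R) : supdist f g = supdist g f.
Proof.
rewrite /supdist; congr nonneg_sup; apply: eq_imagel => t _.
exact: absdiffC.
Qed.

Lemma le_add_supdist (T : Type) (f g : T -> \bar R) (t : T) :
  0 <= f t -> 0 <= g t -> f t <= g t + supdist f g.
Proof.
move=> f0 g0; apply: (le_trans (le_add_absdiff f0 g0)).
by apply: leeD2l; apply: nonneg_sup_ub; exists t.
Qed.

End NonnegExtended.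

(** Lift an independent family in the range of [f] to vectors [u i]. Since [k] sends [g (h (u i))]
    to [f (u i)], it carries any linear relation among the former to one among the latter, so the
    former are independent too. *)
Lemma rank_factor (R : realType) (F : fieldType) (U U' W' W : lmodType F)
    (f : {linear U -> W}) (g : {linear U' -> W'})
    (h : {linear U -> U'}) (k : {linear W' -> W}) :
  (forall u, f u = k (g (h u))) -> rank R f <= rank R g.
Proof.
move=> fE; apply: ge_ereal_sup => _ [m [v [vfree vf]] <-].
have /choice [u uE] : forall i, exists u, f u = v i.
  by move=> i; have [u _ <-] := vf i; exists u.
apply: ereal_sup_ubound; exists m => //; exists (fun i => g (h (u i))); split.
  move=> c c0; apply: vfree; have := congr1 k c0; rewrite linear0 linear_sum.
  apply: etrans; apply: eq_bigr => i _.
  by rewrite linearZ /= -fE uE.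
by move=> i; exists (h (u i)).
Qed.

Section RealTimesPoset.
Context {R : realType} {disp : Order.disp_t} {P : porderType disp}.

Lemma shift_ptNK (e : R) (x : R *p P) : shift_pt e (shift_pt (- e) x) = x.
Proof. by case: x => r p; rewrite /shift_pt /= subrK. Qed.

Lemma interleaved_sym (F : fieldType) (V V' : pmodule F (R *p P)) (e : R)
  (e0 : (0 <= e)%R) : interleaved V V' e0 -> interleaved V' V e0.
Proof. by move=> [phi [psi [psiphi phipsi]]]; exists psi, phi. Qed.

Lemma interleaved_rank_le (F : fieldType) (V V' : pmodule F (R *p P)) (e : R)
    (e0 : (0 <= e)%R) (a b : R *p P) (ab : (a <= b)%O)
    (ab' : (shift_pt (- e) a <= shift_pt e b)%O) :
  interleaved V V' e0 -> rank_invariant R V ab' <= rank_invariant R V' ab.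
Proof.
move=> [phi [psi [psiphi _]]].
have aE := shift_ptNK e a.
(* [a] is replaced by [shift_pt e c], so that [phi c] lands in [V' a] without
   a transport along [aE]. *)
move: (shift_pt (- e) a) aE ab' => c ca; subst a => ab'.
apply: (@rank_factor R F _ _ _ _ _ _ (phi c) (psi b)) => v.
(* Naturality moves [psi] in front of the map of [V'], where it composes with [phi c] to a map of
   [V]. What remains is functoriality of [V] along [c <= shift_pt e (shift_pt e c) <= shift_pt e
   b]. *)
rewrite pmor_natural psiphi; exact: (@pm_comp _ _ _ V).
Qed.


Lemma sum_quasimetric_perturb (dP dP' : P * P -> \bar R) (k e : R)
    (x y x' y' : R *p P) :
  dP (x.2, y.2) <= dP' (x.2, y.2) + k%:E -> x'.2 = x.2 -> y'.2 = y.2 ->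
  (`|x'.1 - y'.1| <= `|x.1 - y.1| + e)%R ->
  sum_quasimetric dP (x', y') <= sum_quasimetric dP' (x, y) + (e + k)%:E.
Proof.
move=> dPk x'2 y'2 xy1; rewrite /sum_quasimetric x'2 y'2.
rewrite [(e + k)%R]addrC EFinD addeACA -EFinD.
by apply: leeD; rewrite ?lee_fin.
Qed.

(** The two entries of the maximum grow by at most [k] and [e], and both are at most [e + k]. This
    constant is the one of the sum case, which lets both cases be treated alike. *)
Lemma max_quasimetric_perturb (dP dP' : P * P -> \bar R) (k e : R)
    (x y x' y' : R *p P) :
  (0 <= k)%R -> (0 <= e)%R ->
  dP (x.2, y.2) <= dP' (x.2, y.2) + k%:E -> x'.2 = x.2 -> y'.2 = y.2 ->
  (`|x'.1 - y'.1| <= `|x.1 - y.1| + e)%R ->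
  max_quasimetric dP (x', y') <= max_quasimetric dP' (x, y) + (e + k)%:E.
Proof.
move=> k0 e0 dPk x'2 y'2 xy1; rewrite /max_quasimetric x'2 y'2 ge_max.
apply/andP; split.
  apply: (le_trans dPk); apply: leeD; first by rewrite le_max lexx.
  by rewrite lee_fin lerDr.
apply: (@le_trans _ _ (`|x.1 - y.1|%:E + (e + k)%:E)).
  by rewrite -EFinD lee_fin; lra.
by apply: leeD2r; rewrite le_max lexx orbT.
Qed.

(** Both shifts turn the difference [x.1 - y.1] into [x.1 - y.1 - e], so one triangle inequality
    gives both bounds. *)
Lemma shift_dist (e : R) (x y : R *p P) : (0 <= e)%R ->
  (`|(shift_pt (- e) x).1 - y.1| <= `|x.1 - y.1| + e)%R /\
  (`|x.1 - (shift_pt e y).1| <= `|x.1 - y.1| + e)%R.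
Proof.
move=> e0; have := ler_normB (x.1 - y.1)%R e; rewrite (ger0_norm e0) /= => le_e.
by split; [rewrite addrAC | rewrite opprD addrA].
Qed.

Lemma landscape_ge0 (F : fieldType) (d : (R *p P) * (R *p P) -> \bar R)
  (V : pmodule F (R *p P)) nx : 0 <= landscape d V nx.
Proof. by case: nx => n x; exact: nonneg_sup_ge0. Qed.

(** The landscape at [x] sees only distances to and from [x], so it is enough to control, by [c],
    their growth when one endpoint is shifted. *)
Lemma interleaved_landscape_le (F : fieldType) (V V' : pmodule F (R *p P))
    (d d' : (R *p P) * (R *p P) -> \bar R) (e c : R) (e0 : (0 <= e)%R) nx :
  (0 <= c)%R -> interleaved V V' e0 ->
  (forall x y, d (shift_pt (- e) x, y) <= d' (x, y) + c%:E) ->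
  (forall x y, d (x, shift_pt e y) <= d' (x, y) + c%:E) ->
  landscape d V nx <= landscape d' V' nx + c%:E.
Proof.
move=> c0 VV' dl dr; case: nx => n x.
have l0 : 0 <= landscape d' V' (n, x) by exact: landscape_ge0.
apply: nonneg_sup_le => [|_ [r [r0 Vr] <-]]; first by rewrite adde_ge0.
(* For [r <= c] the radius [r - c] may be negative, hence not admissible; nonnegativity of the
   landscape suffices there. *)
have [rc|cr] := leP r c; first by rewrite -[leLHS]add0e; apply: leeD.
rewrite -leeBlDr // -EFinB; apply: nonneg_sup_ub.
exists (r - c)%R => //; split; first by rewrite subr_ge0 ltW.
move=> a b ax xb dax dxb.
have ax' : (shift_pt (- e) a <= x)%O.
  by apply: le_trans ax; rewrite -{2}(shift_ptNK e a); exact: shift_pt_ge.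
have xb' : (x <= shift_pt e b)%O := le_trans xb (shift_pt_ge e0 b).
apply: le_trans (interleaved_rank_le (le_trans ax xb) (le_trans ax' xb') VV').
apply: Vr.
  by apply: (le_trans (dl _ _)); rewrite -leeBrDr // -EFinB.
by apply: (le_trans (dr _ _)); rewrite -leeBrDr // -EFinB.
Qed.

Lemma interleaved_landscape_le_supdist (F : fieldType)
    (V V' : pmodule F (R *p P)) (dP dP' : P * P -> \bar R)
    (hdP : extended_quasimetric dP) (hdP' : extended_quasimetric dP')
    (d d' : (R *p P) * (R *p P) -> \bar R)
    (hd : (d = sum_quasimetric dP /\ d' = sum_quasimetric dP') \/
          (d = max_quasimetric dP /\ d' = max_quasimetric dP'))
    (e : R) (e0 : (0 <= e)%R) nx :
  interleaved V V' e0 ->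
  landscape d V nx <= landscape d' V' nx + (e%:E + supdist dP dP').
Proof.
move=> VV'; have dPP' p q : dP (p, q) <= dP' (p, q) + supdist dP dP'.
  by apply: le_add_supdist; exact: eqm_ge0.
have := nonneg_sup_ge0 (range (fun t => absdiff (dP t) (dP' t))).
move: dPP'; rewrite -/(supdist dP dP').
case: (supdist dP dP') => [k| |] dPP' k0 //; last first.
  (* Case [supdist dP dP' = +oo]: the right side is [+oo], because the landscape is not [-oo]. *)
  by rewrite !addey ?leey // gt_eqF // (lt_le_trans _ (landscape_ge0 _ _ _)).
rewrite -EFinD; rewrite lee_fin in k0.
apply: (interleaved_landscape_le _ _ VV'); first exact: addr_ge0.
  move=> x y; have [sl _] := shift_dist x y e0.
  by case: hd => -[-> ->]; [exact: sum_quasimetric_perturb|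
                             exact: max_quasimetric_perturb].
move=> x y; have [_ sr] := shift_dist x y e0.
by case: hd => -[-> ->]; [exact: sum_quasimetric_perturb|
                             exact: max_quasimetric_perturb].
Qed.

End RealTimesPoset.

Theorem theorem4p3p1 (R : realType) (F : fieldType) (disp : Order.disp_t)
    (P : porderType disp) (V V' : pmodule F (R *p P))
    (dP dP' : P * P -> \bar R)
    (hdP : extended_quasimetric dP) (hdP' : extended_quasimetric dP')
    (d d' : (R *p P) * (R *p P) -> \bar R)
    (hd : (d = sum_quasimetric dP /\ d' = sum_quasimetric dP') \/
          (d = max_quasimetric dP /\ d' = max_quasimetric dP')) :
  supdist (landscape d V) (landscape d' V')
    <= interleaving_dist V V' + supdist dP dP'.
Proof.
have hd' : (d' = sum_quasimetric dP' /\ d = sum_quasimetric dP) \/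
           (d' = max_quasimetric dP' /\ d = max_quasimetric dP).
  by case: hd => -[]; [left|right].
have k0 : 0 <= supdist dP dP' by exact: nonneg_sup_ge0.
(* The bound is proved for each interleaving parameter [e] first, as the infimum need not be
   attained. *)
have VV'_le e (e0 : (0 <= e)%R) : interleaved V V' e0 ->
    supdist (landscape d V) (landscape d' V') <= e%:E + supdist dP dP'.
  move=> VV'; have ek0 : 0 <= e%:E + supdist dP dP' by rewrite adde_ge0.
  apply: nonneg_sup_le => // _ [nx _ <-].
  apply: absdiff_le; rewrite ?landscape_ge0 //.
    exact: interleaved_landscape_le_supdist hd _ _ _ VV'.
  (* The reverse estimate is the same lemma with the roles of [V] and [V'] exchanged. *)
  rewrite supdistC.
  exact: interleaved_landscape_le_supdist hd' _ _ _ (interleaved_sym VV').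
have int0 : 0 <= interleaving_dist V V'.
  by apply: le_ereal_inf_tmp => _ [e [e0 _] <-]; rewrite lee_fin.
case: (supdist dP dP') k0 VV'_le => [k| |] // _ VV'_le; last first.
  by rewrite addey ?leey // gt_eqF // (lt_le_trans _ int0).
(* Subtracting the finite [k] leaves a lower bound for the set of parameters, which also covers the
   empty set, whose infimum is [+oo]. *)
rewrite -leeBlDr //; apply: le_ereal_inf_tmp => _ [e [e0 VV'] <-].
by rewrite leeBlDr //; exact: VV'_le VV'.
Qed.
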